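(* Let $\delta>0$ and $\mathcal{K}=\{\bm{C}\mid \|\bm{C}\|_{tr}\le\delta,\ \bm{C}\in\mathcal{S}^{(d+1)\times(d+1)}\}$. In the Online Compact Convexified Factorization Machine (OCCFM) algorithm described in the context, the linear optimization subroutine amounts to the computation of maximal singular vectors: for every round $t$, given $\bm{C}_t\in\mathcal{K}$, $$\bm{\hat{C}}_t=\mathop{\mathrm{argmin}}_{\bm{C}\in\mathcal{K}}\ \langle \bm{C},\nabla F_t(\bm{C}_t)\rangle=\delta\,\bm{u}_1\bm{v}_1^T,$$ where $\bm{u}_1$ and $\bm{v}_1$ are the (left and right, respectively) maximal singular vectors of $-\nabla F_t(\bm{C}_t)$.
   Context: $\mathcal{S}^{n\times n}$ is the set of real symmetric $n\times n$ matrices; $\|\bm{C}\|_{tr}$ is the nuclear norm (sum of singular values); $\langle \bm{A},\bm{B}\rangle=\mathrm{tr}(\bm{A}^T\bm{B})$. For an SVD $\bm{A}=\sum_i\sigma_i\bm{u}_i\bm{v}_i^T$ with $\sigma_1\ge\sigma_2\ge\cdots\ge 0$, the vectors $\bm{u}_1,\bm{v}_1$ are called the left and right maximal singular vectors of $\bm{A}$. Losses: at round $t$ an instance $(\bm{x}_t,y_t)$ with $\bm{x}_t\in\mathbb{R}^d$ arrives; set $\bm{\hat{x}}_t=[\bm{x}_t^T,1]^T\in\mathbb{R}^{d+1}$. The prediction is $\hat{y}_t(\bm{C})=\frac12\bm{\hat{x}}_t^T\bm{C}\bm{\hat{x}}_t$ and the loss is $f_t(\bm{C})=\ell_t(\hat{y}_t(\bm{C}))$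 with $\ell_t:\mathbb{R}\to\mathbb{R}$ a differentiable convex function, so that $\nabla f_t(\bm{C})=\frac12\ell_t'(\hat y_t(\bm{C}))\,\bm{\hat{x}}_t\bm{\hat{x}}_t^T$. OCCFM algorithm, with parameters $\eta>0$ and $\gamma_t=t^{-1/2}$: initialize $\bm{C}_1\in\mathcal{K}$. For $t=1,\dots,T$: receive $(\bm{x}_t,y_t)$ and incur $f_t(\bm{C}_t)$; let $F_t(\bm{C})=\eta\sum_{\tau=1}^{t-1}\langle\nabla f_\tau(\bm{C}_\tau),\bm{C}\rangle+\|\bm{C}-\bm{C}_1\|_2^2$, where $\|\cdot\|_2$ is the entrywise Euclidean (Frobenius) norm, so $\nabla F_t(\bm{C})=\eta\sum_{\tau=1}^{t-1}\nabla f_\tau(\bm{C}_\tau)+2(\bm{C}-\bm{C}_1)$; compute the left and right maximal singular vectors $\bm{u},\bm{v}$ of $-\nabla F_t(\bm{C}_t)$; set $\bm{\hat{C}}_t=\delta\bm{u}\bm{v}^T$; set $\bm{C}_{t+1}=(1-\gamma_t)\bm{C}_t+\gamma_t\bm{\hat{C}}_t$.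
   Formalization: δu₁v₁ᵀ may be non-symmetric, so outside K (e.g. t=1, zero gradient). Proved: some maximal pair gives a minimizer; every pair attains a value ≤ all of K; it is a minimizer iff symmetric, always unless ±σ₁ are both eigenvalues; argmin is the single point if σ₁>0 is simple. *)

(* Defs.v *)
From HB Require Import structures.
From mathcomp Require Import all_boot all_order all_algebra.
From mathcomp Require Import all_classical all_reals all_analysis.
Import Order.TTheory GRing.Theory Num.Theory.
Import numFieldNormedType.Exports.

Set Implicit Arguments.
Unset Strict Implicit.
Unset Printing Implicit Defensive.

Local Open Scope classical_set_scope.
Local Open Scope ring_scope.

Definition frob_dot (R : realType) (n : nat) (A B : 'M[R]_n) : R :=
  \tr (A^T *m B).

Definition frob_norm (R : realType) (n : nat) (A : 'M[R]_n) : R :=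
  Num.sqrt (\sum_i \sum_j A i j ^+ 2).

(* The gradient for the inner product [frob_dot]: the matrix of the partial
   derivatives with respect to the n * n entries. *)
Definition gradient (R : realType) (n : nat) (f : 'M[R]_n -> R) (A : 'M[R]_n) :
    'M[R]_n :=
  \matrix_(i, j) 'D_(delta_mx i j) (f : 'M[R]_n -> R^o) A.

(* A = \sum_i s_i u_i v_i^T, where u_i and v_i are the columns of the orthogonal
   matrices U and V and s_0 >= s_1 >= ... >= 0. *)
Definition is_svd (R : realType) (n : nat) (A U : 'M[R]_n) (s : 'rV[R]_n)
    (V : 'M[R]_n) : Prop :=
  [/\ U^T *m U = 1%:M,
      V^T *m V = 1%:M,
      forall i, 0 <= s 0 i,
      forall i j : 'I_n, (i <= j)%N -> s 0 j <= s 0 i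
    & A = \sum_i s 0 i *: (col i U *m (col i V)^T)].

Definition maximal_singular_vectors (R : realType) (n : nat)
    (A : 'M[R]_n.+1) (u v : 'cV[R]_n.+1) : Prop :=
  exists U s V, [/\ is_svd A U s V, u = col ord0 U & v = col ord0 V].

(* Every real square matrix has an SVD, and its row of singular values does not
   depend on the choice of the SVD, so the default value 0 is never used. *)
Definition singular_values (R : realType) (n : nat) (A : 'M[R]_n) : 'rV[R]_n :=
  xget 0 [set s | exists U V, is_svd A U s V].

Definition nuclear_norm (R : realType) (n : nat) (A : 'M[R]_n) : R :=
  \sum_i singular_values A 0 i.

Definition nuclear_ball (R : realType) (n : nat) (delta : R) : set 'M[R]_n :=
  [set A | A^T = A /\ nuclear_norm A <= delta].

Definition argmin (R : realType) (T : Type) (K : set T) (f : T -> R) : set T :=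
  [set x | K x /\ forall y, K y -> f x <= f y].

Section OCCFM.
Variables (R : realType) (d : nat).

Definition xhat (x : 'cV[R]_d) : 'cV[R]_d.+1 :=
  castmx (addn1 d, erefl 1%N) (col_mx x (1%:M : 'cV[R]_1)).

Definition prediction (x : 'cV[R]_d) (A : 'M[R]_d.+1) : R :=
  2^-1 * ((xhat x)^T *m A *m xhat x) 0 0.

(* [l] is the scalar loss of the round; the label is part of it. *)
Definition fm_loss (l : R -> R) (x : 'cV[R]_d) (A : 'M[R]_d.+1) : R :=
  l (prediction x A).

Definition surrogate (eta : R) (x : nat -> 'cV[R]_d) (l : nat -> R -> R)
    (C : nat -> 'M[R]_d.+1) (t : nat) (A : 'M[R]_d.+1) : R :=
  eta * (\sum_(1 <= tau < t)
           frob_dot (gradient (fm_loss (l tau) (x tau)) (C tau)) A)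
  + frob_norm (A - C 1%N) ^+ 2.

Definition step_size (t : nat) : R := t%:R `^ (- 2^-1).

(* Rounds are numbered from 1. The maximal singular vectors need not be unique;
   in each round an arbitrary pair may be chosen. *)
Record occfm_run (delta eta : R) (T : nat) (x : nat -> 'cV[R]_d)
    (l : nat -> R -> R) (C Chat : nat -> 'M[R]_d.+1) : Prop := OCCFMRun {
  occfm_init : nuclear_ball delta (C 1%N);
  occfm_linear_opt : forall t, (1 <= t <= T)%N ->
    exists u v,
      maximal_singular_vectors (- gradient (surrogate eta x l C t) (C t)) u v
      /\ Chat t = delta *: (u *m v^T);
  occfm_update : forall t, (1 <= t <= T)%N ->
    C t.+1 = (1 - step_size t) *: C t + step_size t *: Chat t }.

End OCCFM.

(* Main.v *)
Require Import Defs.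
From HB Require Import structures.
From mathcomp Require Import all_boot all_order all_algebra.
From mathcomp Require Import all_classical all_reals all_analysis.
From mathcomp Require Import all_fingroup ring complex.
Import Order.TTheory GRing.Theory Num.Theory.
Import numFieldNormedType.Exports.

Set Implicit Arguments.
Unset Strict Implicit.
Unset Printing Implicit Defensive.

Local Open Scope classical_set_scope.
Local Open Scope ring_scope.

(* Every partial gradient is symmetric, since each loss and the surrogate take
   the same value along V and along V^T; hence G is symmetric even though
   Chat_t, and with it C_{t+1}, need not be. Symmetric matrices have SVDs by the
   spectral theorem. For an SVD -G = \sum_i s_i u_i v_i^T and unit vectors x, y,
   one has x^T (-G) y <= s_0, so expanding A in the ball along its own SVD gives
   <A, -G> <= s_0 ||A||_tr <= delta s_0, which delta u_0 v_0^T attains. This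
   matrix has nuclear norm delta, so it lies in the ball exactly when it is
   symmetric. The equality case of the two bounds gives uniqueness when s_0 is
   positive and simple. *)

(** * The spectral theorem for real symmetric matrices *)

Section SymmetricSpectral.
Variable R : realType.

Lemma mul_block_diag m n (A1 A2 : 'M[R]_m) (B1 B2 : 'M[R]_n) :
  block_mx A1 0 0 B1 *m block_mx A2 0 0 B2 = block_mx (A1 *m A2) 0 0 (B1 *m B2).
Proof. by rewrite mulmx_block !mulmx0 !mul0mx !addr0 !add0r. Qed.

Lemma mulmx_rVE n (w z : 'rV[R]_n) : w *m z^T = (\sum_i w 0 i * z 0 i)%:M.
Proof.
rewrite [LHS]mx11_scalar mxE; congr (_%:M).
by apply: eq_bigr => i _; rewrite mxE.
Qed.

Lemma sum_sqr_eq0 n (w : 'rV[R]_n) : \sum_i w 0 i ^+ 2 = 0 -> w = 0.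
Proof.
move=> /eqP; rewrite psumr_eq0 => [/allP w0|i _]; last exact: sqr_ge0.
apply/rowP => i; rewrite mxE; apply/eqP.
by rewrite -sqrf_eq0; apply: w0; rewrite mem_index_enum.
Qed.

(** The reflection across the hyperplane orthogonal to [q - delta_mx 0 0] exchanges these two unit
    vectors. It serves to rotate a unit eigenvector onto the first basis vector. *)
Lemma householder n (q : 'rV[R]_n.+1) : q *m q^T = 1%:M ->
  exists H : 'M[R]_n.+1, [/\ H^T = H, H *m H = 1%:M & delta_mx 0 0 *m H = q].
Proof.
move=> qq; have [w wE] : exists w, w = q - delta_mx 0 0 by eexists.
pose c := \sum_i w 0 i ^+ 2.
have wwT : w *m w^T = c%:M.
  by rewrite mulmx_rVE; congr (_%:M); apply: eq_bigr => i _; rewrite expr2.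
(* For [c = 0] the vector [q] is already the first basis vector, and there is no direction to
   reflect along. *)
have [c0|c_neq0] := eqVneq c 0.
  exists 1%:M; rewrite trmx1 !mulmx1; split=> //.
  by apply/eqP; rewrite eq_sym -subr_eq0 -wE; apply/eqP/sum_sqr_eq0.
have eqT : (delta_mx 0 0 : 'rV[R]_n.+1) *m q^T = (q 0 0)%:M.
  by rewrite [LHS]mx11_scalar -rowE !mxE.
have qeT : q *m (delta_mx 0 0 : 'rV[R]_n.+1)^T = (q 0 0)%:M.
  by rewrite -[LHS]trmxK trmx_mul trmxK eqT tr_scalar_mx.
have eeT : (delta_mx 0 0 : 'rV[R]_n.+1) *m (delta_mx 0 0 : 'rV[R]_n.+1)^T = 1%:M.
  by rewrite trmx_delta mul_delta_mx [LHS]mx11_scalar mxE.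
have ewT : (delta_mx 0 0 : 'rV[R]_n.+1) *m w^T = (q 0 0 - 1)%:M.
  by rewrite wE linearB /= mulmxBr eqT eeT -raddfB.
(* Expansion of the squared length of a difference of two unit vectors. It makes the coefficient of
   [w] in the image of the basis vector equal to 1. *)
have cE : c = 2 - 2 * q 0 0.
  have : c%:M = (2 - 2 * q 0 0)%:M :> 'M[R]_1.
    rewrite -wwT {1}wE mulmxBl ewT wE linearB /= mulmxBr qq qeT.
    by rewrite -!raddfB /=; congr (_%:M); ring.
  by move=> /matrixP /(_ 0 0); rewrite !mxE eqxx !mulr1n.
exists (1%:M - (2 / c) *: (w^T *m w)); split.
- by rewrite linearB linearZ /= trmx_mul trmxK trmx1.
- rewrite mulmxBl mul1mx mulmxBr mulmx1 -scalemxAl -scalemxAr scalerA.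
  rewrite mulmxA -(mulmxA w^T w) wwT mul_mx_scalar -scalemxAl scalerA.
  suff -> : 2 / c * (2 / c) * c = 2 / c + 2 / c.
    by rewrite scalerDl opprB addrK subrK.
  by field.
- rewrite mulmxBr mulmx1 -scalemxAr mulmxA ewT mul_scalar_mx scalerA.
  have -> : 2 / c * (q 0 0 - 1) = -1 by rewrite cE; field; rewrite -cE.
  by rewrite scaleN1r opprK wE addrC subrK.
Qed.

(** Over the complex numbers an eigenvalue [z] exists. As [A] is real and symmetric, evaluating
    [v A w^T], with [w] the conjugate of [v], from either side gives [z |v|^2 = z^* |v|^2], so [z]
    is real and a root of the real characteristic polynomial. *)
Lemma symmetric_eigenvalue n (A : 'M[R]_n.+1) : A^T = A ->
  exists a, eigenvalue A a.
Proof.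
move=> symA; pose f : {rmorphism R -> complex R} := real_complex R.
have [z] := @eigenvalue_closed (complex R) _ (map_mx f A) isT.
move=> /eigenvalueP[v vA v_neq0].
have /complex_realP[a za] : z \is Num.real.
  have vv : 0 < \sum_i `|v 0 i| ^+ 2.
    rewrite lt_def sumr_ge0 ?andbT => [|i _]; last exact: exprn_ge0.
    apply: contra_neq v_neq0 => /eqP.
    rewrite psumr_eq0 => [|i _]; last exact: exprn_ge0.
    move=> /allP v0; apply/rowP => i; rewrite mxE; apply/eqP.
    by rewrite -normr_eq0 -sqrf_eq0; apply: v0; rewrite mem_index_enum.
  pose w := map_mx Num.conj v.
  have wA : w *m map_mx f A = z^* *: w.
    rewrite -map_mxZ -vA map_mxM; congr (_ *m _).
    by apply/matrixP => i j; rewrite !mxE;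
      apply/esym/CrealP; rewrite complex_real.
  have : (z *: v) *m w^T = v *m (z^* *: w)^T.
    rewrite -wA -vA trmx_mul -mulmxA; congr (_ *m (_ *m _)).
    by apply/matrixP => i j; rewrite !mxE -{1}symA mxE.
  have E : v *m w^T = (\sum_i `|v 0 i| ^+ 2)%:M.
    rewrite [LHS]mx11_scalar mxE; congr (_%:M).
    by apply: eq_bigr => i _; rewrite !mxE normCK.
  rewrite -scalemxAl linearZ /= -scalemxAr E => /matrixP /(_ 0 0).
  rewrite !mxE eqxx mulr1n => /(mulIf (lt0r_neq0 vv)) h.
  by apply/CrealP.
exists a; rewrite eigenvalue_root_char -(fmorph_root f) -[f a]za map_char_poly.
by rewrite -eigenvalue_root_char; apply/eigenvalueP; exists v.
Qed.

(** Induction on the size by deflation: a reflection carries a unit eigenvector to the first basis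
    vector, and symmetry then splits off a 1 by 1 block. *)
Lemma symmetric_spectral n (A : 'M[R]_n) : A^T = A ->
  exists (Q : 'M[R]_n) (a : 'rV[R]_n),
    Q^T *m Q = 1%:M /\ A = Q *m diag_mx a *m Q^T.
Proof.
elim: n A => [|n IHn] A symA.
  by exists 1%:M, 0; split; apply/matrixP; case.
have [a /eigenvalueP[v vA v_neq0]] := symmetric_eigenvalue symA.
have vv : 0 < \sum_i v 0 i ^+ 2.
  rewrite lt_def sumr_ge0 ?andbT => [|i _]; last exact: sqr_ge0.
  by apply: contra_neq v_neq0; apply: sum_sqr_eq0.
pose r := Num.sqrt (\sum_i v 0 i ^+ 2); have r_gt0 : 0 < r by rewrite sqrtr_gt0.
pose q := r^-1 *: v.
have qq : q *m q^T = 1%:M.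
  rewrite mulmx_rVE; congr (_%:M).
  under eq_bigr => i _ do rewrite !mxE mulrACA -expr2 -expr2.
  by rewrite -mulr_sumr exprVn sqr_sqrtr ?ltW // mulVf // gt_eqF.
have qA : q *m A = a *: q by rewrite -scalemxAl vA !scalerA mulrC.
have [H [symH HH eH]] := householder qq.
(* [B] is [A] after the reflection; its first row is [a] times the first basis vector, and by
   symmetry so is its first column. *)
have [B BE0] : exists B : 'M[R]_n.+1, B = H *m A *m H by eexists.
have symB : B^T = B by rewrite BE0 !trmx_mul symH symA mulmxA.
have eB : delta_mx 0 0 *m B = a *: delta_mx 0 0 :> 'rV_n.+1.
  rewrite BE0 !mulmxA eH qA -scalemxAl; congr (_ *: _).
  by rewrite -eH -mulmxA HH mulmx1.
have B0 j : B 0 j = a * (j == 0)%:R.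
  by have /rowP /(_ j) := eB; rewrite -rowE !mxE /= => ->.
change 'M[R]_(1 + n) in B.
have [Q [b [QQ dsubB]]] := IHn (drsubmx B) ltac:(by rewrite trmx_drsub symB).
have BE : B = block_mx a%:M 0 0 (drsubmx B).
  have ur : ursubmx B = 0.
    apply/matrixP => i j; rewrite !mxE ord1.
    have -> : lshift n (0 : 'I_1) = 0 by apply/val_inj.
    by rewrite B0 mulr0.
  rewrite -[LHS]submxK ur; congr block_mx.
    rewrite [LHS]mx11_scalar !mxE; congr (_%:M).
    have -> : lshift n (0 : 'I_1) = 0 by apply/val_inj.
    by rewrite B0 mulr1.
  by rewrite -[LHS]trmxK trmx_dlsub symB ur trmx0.
pose P : 'M[R]_(1 + n) := block_mx 1%:M 0 0 Q.
have PP : P^T *m P = 1%:M.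
  rewrite /P tr_block_mx !trmx0 mul_block_diag trmx1 mulmx1 QQ.
  by rewrite -scalar_mx_block.
exists (H *m P), (row_mx a%:M b); split.
  by rewrite trmx_mul symH -mulmxA (mulmxA H) HH mul1mx.
have diagE : diag_mx (row_mx (a%:M : 'rV_1) b) = block_mx a%:M 0 0 (diag_mx b).
  rewrite diag_mx_row; congr block_mx.
  by apply/matrixP => i j; rewrite !mxE !ord1 !eqxx.
have PBP : P *m diag_mx (row_mx (a%:M : 'rV_1) b) *m P^T = B.
  rewrite diagE BE /P tr_block_mx !trmx0 !mul_block_diag.
  by rewrite trmx1 mulmx1 mul1mx dsubB.
have -> : A = H *m B *m H by rewrite BE0 !mulmxA HH mul1mx -mulmxA HH mulmx1.
by rewrite trmx_mul symH -PBP !mulmxA.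
Qed.

End SymmetricSpectral.

(** * Singular value decompositions and the nuclear norm *)

Section SingularValues.
Variable R : realType.

Lemma mulmx_diag_trE n (U V : 'M[R]_n) (s : 'rV[R]_n) :
  U *m diag_mx s *m V^T = \sum_i s 0 i *: (col i U *m (col i V)^T).
Proof.
apply/matrixP => i j; rewrite summxE !mxE; apply: eq_bigr => k _.
by rewrite mul_mx_diag !mxE big_ord1 !mxE; ring.
Qed.

(** The absolute eigenvalues in decreasing order are the singular values, and the signs are absorbed
    into [U]. The proportionality of the two families makes each [u_i v_i^T] symmetric. *)
Lemma symmetric_svd n (A : 'M[R]_n) : A^T = A ->
  exists U s V, is_svd A U s V /\
    forall i, exists e, col i U = e *: col i V.
Proof.
move=> /symmetric_spectral [Q [a [QQ AE]]].
pose geA := relpre (fun i => `|a 0 i|) (>=%R : rel R).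
have geA_total : total geA by move=> i j; exact: ge_total.
have geA_trans : transitive geA by move=> i j k /= ij jk; exact: le_trans jk ij.
have /tuple_permP[p pE] : perm_eq (sort geA (ord_tuple n)) (ord_tuple n).
  by rewrite perm_sort.
have p_anti (i j : 'I_n) : (i <= j)%N -> `|a 0 (p j)| <= `|a 0 (p i)|.
  move=> ij; have := sort_sorted geA_total (ord_tuple n); rewrite pE => srt.
  have := sorted_leq_nth geA_trans (fun i => lexx _) i srt.
  move=> /(_ i j); rewrite !inE !size_tuple !ltn_ord => /(_ isT isT ij).
  by rewrite -!tnth_nth !tnth_mktuple !tnth_ord_tuple.
(* The sign is 1 at 0, not 0, so that [U] stays orthogonal when [A] is singular. *)
pose sg (x : R) : R := if x < 0 then -1 else 1.
have sgM x : sg x * sg x = 1 by rewrite /sg; case: ifP; rewrite ?mulrNN mulr1.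
have sgE x : `|x| * sg x = x.
  rewrite /sg; case: ltP => x0; first by rewrite ltr0_norm // mulrNN mulr1.
  by rewrite ger0_norm // mulr1.
pose V := col_perm p Q; pose U := \matrix_(i, j) (sg (a 0 (p j)) * V i j).
have VV : V^T *m V = 1%:M.
  apply/matrixP => i j; have /matrixP /(_ (p i) (p j)) := QQ.
  rewrite !mxE (inj_eq perm_inj) => <-; apply: eq_bigr => k _.
  by rewrite !mxE.
have UU : U^T *m U = 1%:M.
  apply/matrixP => i j.
  transitivity (sg (a 0 (p i)) * sg (a 0 (p j)) * (V^T *m V) i j).
    rewrite !mxE mulr_sumr; apply: eq_bigr => k _.
    by rewrite !mxE mulrACA.
  by rewrite VV mxE; case: eqP => [->|_]; rewrite ?mulr0 // sgM mulr1.
exists U, (\row_i `|a 0 (p i)|), V; split; last first.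
  by move=> i; exists (sg (a 0 (p i))); apply/matrixP => k l; rewrite !mxE.
split=> // [i|i j ij|]; rewrite ?mxE ?normr_ge0 ?p_anti //.
rewrite AE mulmx_diag_trE (reindex_inj (@perm_inj _ p)) /=.
apply: eq_bigr => i _; rewrite mxE; apply/matrixP => k l.
by rewrite !mxE !big_ord1 !mxE -{1}[a 0 (p i)]sgE; ring.
Qed.

Lemma orthogonal_sum_sqr n (Q : 'M[R]_n) (x : 'cV[R]_n) : Q^T *m Q = 1%:M ->
  x^T *m x = 1%:M -> \sum_i (Q^T *m x) i 0 ^+ 2 = 1.
Proof.
move=> /mulmx1C QQ xx; have : (Q^T *m x)^T *m (Q^T *m x) = 1%:M.
  by rewrite trmx_mul trmxK mulmxA -(mulmxA _ Q) QQ mulmx1.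
move=> /matrixP /(_ 0 0); rewrite mxE [RHS]mxE eqxx mulr1n => <-.
by apply: eq_bigr => i _; rewrite [_^T 0 i]mxE expr2.
Qed.

Section SVD.
Variables (n : nat) (A U V : 'M[R]_n) (s : 'rV[R]_n).
Hypothesis svdA : is_svd A U s V.

Lemma svd_fact : A = U *m diag_mx s *m V^T.
Proof. by case: svdA => _ _ _ _ ->; rewrite mulmx_diag_trE. Qed.

Lemma svd_mulVr : A *m V = U *m diag_mx s.
Proof. by case: svdA => _ VV _ _ _; rewrite svd_fact -mulmxA VV mulmx1. Qed.

Lemma svd_mulUl : U^T *m A = diag_mx s *m V^T.
Proof. by case: svdA => UU _ _ _ _; rewrite svd_fact !mulmxA UU mul1mx. Qed.

Lemma svd_bilinear (x y : 'cV[R]_n) : (x^T *m A *m y) 0 0 =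
  \sum_i s 0 i * ((U^T *m x) i 0 * (V^T *m y) i 0).
Proof.
rewrite svd_fact.
have -> : x^T *m (U *m diag_mx s *m V^T) *m y =
    (U^T *m x)^T *m diag_mx s *m (V^T *m y).
  by rewrite trmx_mul trmxK !mulmxA.
rewrite mxE; apply: eq_bigr => i _.
by rewrite mul_mx_diag mxE [_^T _ _]mxE; ring.
Qed.

End SVD.

Lemma orthonormal_col n (Q : 'M[R]_n) i : Q^T *m Q = 1%:M ->
  (col i Q)^T *m col i Q = 1%:M.
Proof.
move=> /matrixP /(_ i i) QQ; rewrite [LHS]mx11_scalar; congr (_%:M).
by move: QQ; rewrite !mxE eqxx mulr1n => <-; apply: eq_bigr => k _; rewrite !mxE.
Qed.

Lemma svd_bilinear_col n (A U V : 'M[R]_n) (s : 'rV[R]_n) i :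
  is_svd A U s V -> ((col i U)^T *m A *m col i V) 0 0 = s 0 i.
Proof.
move=> svdA; have [_ VV _ _ _] := svdA.
rewrite tr_col -row_mul (svd_mulUl svdA) (colE i V) mulmxA -row_mul -mulmxA VV.
by rewrite mulmx1 -colE !mxE eqxx mulr1n.
Qed.

(** Each [r_i] is [x_i^T A y_i]. Expanded along the first SVD, the total weight of [s_j] is a sum of
    products of coordinates of two unit vectors, hence at most 1. *)
Lemma svd_sum_le n (A U V X Y : 'M[R]_n) (s r : 'rV[R]_n) :
  is_svd A U s V -> is_svd A X r Y -> \sum_i r 0 i <= \sum_i s 0 i.
Proof.
move=> svdA svdA'; have [UU VV s_ge0 _ _] := svdA; have [XX YY _ _ _] := svdA'.
under eq_bigr => i _ do rewrite -(svd_bilinear_col i svdA') (svd_bilinear svdA).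
rewrite exchange_big /=; apply: ler_sum => j _; rewrite -mulr_sumr.
rewrite -[leRHS]mulr1 ler_wpM2l //.
have sum1 (P Q : 'M[R]_n) : P^T *m P = 1%:M -> Q^T *m Q = 1%:M ->
    \sum_i (P^T *m col i Q) j 0 ^+ 2 = 1.
  move=> PP QQ; have /mulmx1C := QQ; move=> QQT.
  have := orthogonal_sum_sqr (Q := Q) (x := col j P) QQ (orthonormal_col j PP).
  move=> <-; apply: eq_bigr => i _; congr (_ ^+ 2).
  by rewrite !mxE; apply: eq_bigr => k _; rewrite !mxE mulrC.
(* 1 is the mean of two squared lengths, which reduces the bound to [a b <= (a^2 + b^2) / 2] term by
   term. *)
have -> : 1 = \sum_i
    ((U^T *m col i X) j 0 ^+ 2 + (V^T *m col i Y) j 0 ^+ 2) / 2 :> R.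
  by rewrite -mulr_suml big_split /= !sum1 //; field.
apply: ler_sum => i _; rewrite ler_pdivlMr // -subr_ge0.
have -> : (U^T *m col i X) j 0 ^+ 2 + (V^T *m col i Y) j 0 ^+ 2 -
    (U^T *m col i X) j 0 * (V^T *m col i Y) j 0 * 2 =
    ((U^T *m col i X) j 0 - (V^T *m col i Y) j 0) ^+ 2 by ring.
exact: sqr_ge0.
Qed.

(** The previous inequality applies in both directions, so any SVD may replace the one chosen by
    [xget]. *)
Lemma nuclear_norm_svd n (A U V : 'M[R]_n) (s : 'rV[R]_n) :
  is_svd A U s V -> nuclear_norm A = \sum_i s 0 i.
Proof.
move=> svdA; have [X [Y svdA']] : exists X Y, is_svd A X (singular_values A) Y.
  rewrite /singular_values; case: xgetP => [r _ //|/(_ s)/=].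
  by move=> nex; case: nex; exists U, V.
by apply/eqP; rewrite eq_le (svd_sum_le svdA svdA') (svd_sum_le svdA' svdA).
Qed.

(** * The largest singular value as the maximum of the bilinear form on unit vectors *)

Section TopSingularValue.
Variables (n : nat) (A U V : 'M[R]_n.+1) (s : 'rV[R]_n.+1).
Hypothesis svdA : is_svd A U s V.

(* The coordinates of [x] along [U] and of [y] along [V] have square sum 1, so
   [s 0 0] is [s 0 0 * (|U^T x|^2 + |V^T y|^2) / 2]; the summand [a b] equals
   [(a^2 + b^2) / 2 - (a - b)^2 / 2]. *)
Lemma svd_bilinear_defect (x y : 'cV[R]_n.+1) : x^T *m x = 1%:M ->
  y^T *m y = 1%:M ->
  s 0 0 - (x^T *m A *m y) 0 0 =
  \sum_i 2^-1 * (s 0 i * ((U^T *m x) i 0 - (V^T *m y) i 0) ^+ 2 +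
    (s 0 0 - s 0 i) * ((U^T *m x) i 0 ^+ 2 + (V^T *m y) i 0 ^+ 2)).
Proof.
case: (svdA) => UU VV _ _ _ xx yy; rewrite (svd_bilinear svdA).
have s0E : s 0 0 = \sum_i s 0 0 *
    (((U^T *m x) i 0 ^+ 2 + (V^T *m y) i 0 ^+ 2) / 2).
  rewrite -mulr_sumr -mulr_suml big_split /= !orthogonal_sum_sqr //.
  by field.
by rewrite {1}s0E -sumrB; apply: eq_bigr => i _; field.
Qed.

Lemma svd_defect_ge0 (x y : 'cV[R]_n.+1) i :
  0 <= 2^-1 * (s 0 i * ((U^T *m x) i 0 - (V^T *m y) i 0) ^+ 2 +
    (s 0 0 - s 0 i) * ((U^T *m x) i 0 ^+ 2 + (V^T *m y) i 0 ^+ 2)).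
Proof.
case: svdA => _ _ s_ge0 s_anti _.
rewrite mulr_ge0 ?invr_ge0 ?ler0n //.
apply: addr_ge0; apply: mulr_ge0; rewrite ?sqr_ge0 ?subr_ge0 ?s_anti //.
by rewrite addr_ge0 ?sqr_ge0.
Qed.

Lemma svd_bilinear_le (x y : 'cV[R]_n.+1) : x^T *m x = 1%:M ->
  y^T *m y = 1%:M -> (x^T *m A *m y) 0 0 <= s 0 0.
Proof.
move=> xx yy; rewrite -subr_ge0 svd_bilinear_defect //.
by apply: sumr_ge0 => i _; exact: svd_defect_ge0.
Qed.

(** Equality makes every summand of the defect vanish. Simplicity of [s 0 0] then kills all
    coordinates but the first, and positivity equates the first coordinates of [x] and [y]. *)
Lemma svd_bilinear_max (x y : 'cV[R]_n.+1) :
  0 < s 0 0 -> (forall i, i != 0 -> s 0 i < s 0 0) ->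
  x^T *m x = 1%:M -> y^T *m y = 1%:M -> (x^T *m A *m y) 0 0 = s 0 0 ->
  x *m y^T = col 0 U *m (col 0 V)^T.
Proof.
move=> s_gt0 s_lt xx yy xAy; have [UU VV s_ge0 _ _] := svdA.
have := svd_bilinear_defect xx yy; rewrite xAy subrr => /esym /eqP.
rewrite psumr_eq0 => [/allP def0|i _]; last exact: svd_defect_ge0.
set a := U^T *m x; set b := V^T *m y.
have terms i : s 0 i * (a i 0 - b i 0) ^+ 2 = 0 /\
    (s 0 0 - s 0 i) * (a i 0 ^+ 2 + b i 0 ^+ 2) = 0.
  have := def0 i (mem_index_enum i); rewrite mulf_eq0 invr_eq0 pnatr_eq0 /=.
  rewrite paddr_eq0; first by move=> /andP[/eqP ? /eqP ?].
    by rewrite mulr_ge0 ?sqr_ge0.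
  apply: mulr_ge0; last by rewrite addr_ge0 ?sqr_ge0.
  rewrite subr_ge0.
  by have [->//|/s_lt/ltW] := eqVneq i 0.
have ab0 i : i != 0 -> a i 0 = 0 /\ b i 0 = 0.
  move=> i0; have [_ /eqP] := terms i; rewrite mulf_eq0 subr_eq0 gt_eqF ?s_lt //=.
  by rewrite paddr_eq0 ?sqr_ge0 // !sqrf_eq0 => /andP[/eqP ? /eqP ?].
have b0 : b 0 0 = a 0 0.
  have [/eqP + _] := terms 0; rewrite mulf_eq0 gt_eqF //= sqrf_eq0 subr_eq0.
  by move=> /eqP.
have colE (Q : 'M[R]_n.+1) (z : 'cV[R]_n.+1) : Q^T *m Q = 1%:M ->
    (forall i, i != 0 -> (Q^T *m z) i 0 = 0) -> z = (Q^T *m z) 0 0 *: col 0 Q.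
  move=> /mulmx1C QQ; rewrite -{2}[z]mul1mx -QQ -mulmxA.
  move: (Q^T *m z) => w w0.
  apply/matrixP => i j; rewrite ord1 mxE (bigD1 ord0) //= big1 => [|k k0].
    by rewrite addr0 !mxE mulrC.
  by rewrite w0 ?mulr0.
have xE : x = a 0 0 *: col 0 U by apply: colE => // i /ab0[].
have yE : y = a 0 0 *: col 0 V by rewrite -b0; apply: colE => // i /ab0[].
(* The common coordinate is 1 or -1; it occurs in both factors of [x *m y^T] and cancels. *)
have a1 : a 0 0 * a 0 0 = 1.
  have := orthogonal_sum_sqr UU xx; rewrite (bigD1 ord0) //= big1 ?addr0 ?expr2 //.
  by move=> i /ab0[->]; rewrite expr0n.
rewrite {1}xE {1}yE linearZ /= -scalemxAl -scalemxAr scalerA a1.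
by rewrite scale1r.
Qed.

Lemma svd_rank_one (c : R) : 0 <= c ->
  is_svd (c *: (col 0 U *m (col 0 V)^T)) U (c *: delta_mx 0 0) V.
Proof.
case: svdA => UU VV _ _ _ c0; split=> // [i|i j ij|].
- by rewrite !mxE mulr_ge0 ?ler0n.
- rewrite !mxE ler_wpM2l // ler_nat !eqxx /=.
  by case: eqP => // j0; move: ij; rewrite j0 leqn0 -val_eqE /= => ->.
- rewrite (bigD1 ord0) //= big1 => [|i i0]; rewrite !mxE ?eqxx ?mulr1 ?addr0 //.
  by rewrite (negPf i0) /= mulr0 scale0r.
Qed.

Lemma nuclear_norm_rank_one (c : R) : 0 <= c ->
  nuclear_norm (c *: (col 0 U *m (col 0 V)^T)) = c.
Proof.
move=> /svd_rank_one /nuclear_norm_svd ->.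
rewrite (bigD1 ord0) //= big1 => [|i i0]; rewrite !mxE ?eqxx ?mulr1 ?addr0 //.
by rewrite (negPf i0) /= mulr0.
Qed.

End TopSingularValue.

Lemma top_singular_value_uniq n (A U V X Y : 'M[R]_n.+1) (s r : 'rV[R]_n.+1) :
  is_svd A U s V -> is_svd A X r Y -> r 0 0 = s 0 0.
Proof.
have le U' V' X' Y' s' r' : is_svd A U' s' V' -> is_svd A X' r' Y' ->
    r' 0 0 <= s' 0 0.
  move=> svdA svdA'; have [XX YY _ _ _] := svdA'.
  by rewrite -(svd_bilinear_col 0 svdA') (svd_bilinear_le svdA) ?orthonormal_col.
move=> svdA svdA'; apply/eqP.
by rewrite eq_le (le _ _ _ _ _ _ svdA svdA') (le _ _ _ _ _ _ svdA' svdA).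
Qed.

End SingularValues.

(** * Symmetry of the loss and surrogate gradients *)

Section SymmetricGradients.
Variable R : realType.

(** The partial derivatives at [(i, j)] and [(j, i)] are limits of the same difference quotient,
    since [delta_mx j i] is the transpose of [delta_mx i j]. *)
Lemma gradient_sym n (f : 'M[R]_n -> R) (A : 'M[R]_n) :
  (forall h V, f (h *: V^T + A) = f (h *: V + A)) ->
  (gradient f A)^T = gradient f A.
Proof.
move=> fT; apply/matrixP => i j; rewrite !mxE /derive -(trmx_delta _ j i).
by under [in RHS]eq_fun => h do rewrite /= /shift fT.
Qed.

Lemma prediction_tr d (x : 'cV[R]_d) A : prediction x A^T = prediction x A.
Proof.
rewrite /prediction; congr (_ * _).
by rewrite -[in LHS](trmxK (xhat x)) -trmx_mul -trmx_mul mulmxA mxE trmxK.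
Qed.

Lemma predictionP d (x : 'cV[R]_d) h A B :
  prediction x (h *: A + B) = h * prediction x A + prediction x B.
Proof.
by rewrite /prediction mulmxDr mulmxDl -scalemxAr -scalemxAl !mxE; ring.
Qed.

Lemma gradient_fm_loss_sym d l (x : 'cV[R]_d) A :
  (gradient (fm_loss l x) A)^T = gradient (fm_loss l x) A.
Proof.
by apply: gradient_sym => h V; rewrite /fm_loss !predictionP prediction_tr.
Qed.

Lemma frob_dot_trr n (A B : 'M[R]_n) : A^T = A -> frob_dot A B^T = frob_dot A B.
Proof.
by move=> symA; rewrite /frob_dot -trmx_mul mxtrace_tr mxtrace_mulC symA.
Qed.

Lemma frob_norm_tr n (A : 'M[R]_n) : frob_norm A^T = frob_norm A.
Proof.
rewrite /frob_norm exchange_big; congr Num.sqrt.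
by apply: eq_bigr => i _; apply: eq_bigr => j _; rewrite mxE.
Qed.

Lemma gradient_surrogate_sym d eta (x : nat -> 'cV[R]_d) l C t :
  (C 1%N)^T = C 1%N -> (C t)^T = C t ->
  (gradient (surrogate eta x l C t) (C t))^T =
    gradient (surrogate eta x l C t) (C t).
Proof.
move=> symC1 symCt; apply: gradient_sym => h V; rewrite /surrogate.
(* As [C t] is symmetric, moving along [V^T] is the transpose of moving along [V]; both terms of the
   surrogate are invariant under transposition. *)
have -> : h *: V^T + C t = (h *: V + C t)^T by rewrite linearD linearZ /= symCt.
congr (_ * _ + _ ^+ 2).
  by apply: eq_bigr => tau _; rewrite frob_dot_trr // gradient_fm_loss_sym.
by rewrite -[in LHS]symC1 -linearB /= frob_norm_tr.
Qed.

End SymmetricGradients.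

(** * Linear optimization over the nuclear norm ball *)

Section LinearOptimization.
Variables (R : realType) (n : nat) (S U V : 'M[R]_n.+1) (s : 'rV[R]_n.+1).
Hypothesis svdS : is_svd S U s V.
Variable delta : R.

Lemma frob_dot_svd (A X Y : 'M[R]_n.+1) (a : 'rV[R]_n.+1) : is_svd A X a Y ->
  frob_dot A S = \sum_i a 0 i * ((col i X)^T *m S *m col i Y) 0 0.
Proof.
case=> _ _ _ _ ->; rewrite /frob_dot !linear_sum mulmx_suml linear_sum /=.
apply: eq_bigr => i _; rewrite linearZ /= -scalemxAl mxtraceZ trmx_mul trmxK.
by rewrite mxtrace_mulC mulmxA mxtrace_mulC mulmxA trace_mx11.
Qed.

Lemma frob_dot_rank_one :
  frob_dot (delta *: (col 0 U *m (col 0 V)^T)) S = delta * s 0 0.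
Proof.
rewrite -(svd_bilinear_col 0 svdS) /frob_dot linearZ /= -scalemxAl mxtraceZ.
by rewrite trmx_mul trmxK mxtrace_mulC mulmxA mxtrace_mulC mulmxA trace_mx11.
Qed.

Lemma nuclear_ball_svd (A : 'M[R]_n.+1) : nuclear_ball delta A ->
  exists X a Y, is_svd A X a Y /\ \sum_i a 0 i <= delta.
Proof.
case=> /symmetric_svd [X [a [Y [svdA _]]]] le_delta.
by exists X, a, Y; rewrite -(nuclear_norm_svd svdA).
Qed.

Lemma frob_dot_le (A : 'M[R]_n.+1) : nuclear_ball delta A ->
  frob_dot A S <= delta * s 0 0.
Proof.
move=> /nuclear_ball_svd [X [a [Y [svdA le_delta]]]].
have [XX YY a_ge0 _ _] := svdA; have [_ _ s_ge0 _ _] := svdS.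
rewrite (frob_dot_svd svdA) (@le_trans _ _ ((\sum_i a 0 i) * s 0 0)) //.
  rewrite mulr_suml; apply: ler_sum => i _.
  by rewrite ler_wpM2l ?(svd_bilinear_le svdS) ?orthonormal_col.
by rewrite ler_wpM2r.
Qed.

(** The gaps [a_i (s_0 - f_i)] are nonnegative, yet add up to [(\sum_i a_i - delta) s_0 <= 0], so
    all vanish. Each term with [a_i] nonzero then has [x_i y_i^T = u_0 v_0^T]. *)
Lemma frob_dot_max (A : 'M[R]_n.+1) :
  0 < s 0 0 -> (forall i, i != 0 -> s 0 i < s 0 0) -> nuclear_ball delta A ->
  frob_dot A S = delta * s 0 0 -> A = delta *: (col 0 U *m (col 0 V)^T).
Proof.
move=> s_gt0 s_lt /nuclear_ball_svd [X [a [Y [svdA le_delta]]]] Amax.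
have [XX YY a_ge0 _ AE] := svdA.
pose f i := ((col i X)^T *m S *m col i Y) 0 0.
have gap_ge0 i : 0 <= a 0 i * (s 0 0 - f i).
  by rewrite mulr_ge0 // subr_ge0 (svd_bilinear_le svdS) ?orthonormal_col.
have gapE : \sum_i a 0 i * (s 0 0 - f i) = (\sum_i a 0 i - delta) * s 0 0.
  rewrite mulrBl -Amax (frob_dot_svd svdA) mulr_suml -sumrB.
  by apply: eq_bigr => i _; rewrite mulrBr.
have gap0 : \sum_i a 0 i * (s 0 0 - f i) = 0.
  apply/eqP; rewrite eq_le sumr_ge0 // andbT gapE.
  by rewrite mulr_le0_ge0 ?subr_le0 // ltW.
(* Since [s_0] is positive, a vanishing total gap forces the norm constraint to be tight. *)
have sum_a : \sum_i a 0 i = delta.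
  move: gapE; rewrite gap0 => /esym/eqP.
  by rewrite mulf_eq0 (gt_eqF s_gt0) orbF subr_eq0 => /eqP.
rewrite AE -sum_a scaler_suml; apply: eq_bigr => i _.
have [->|ai0] := eqVneq (a 0 i) 0; first by rewrite !scale0r.
congr (_ *: _); apply: (svd_bilinear_max svdS) => //; rewrite ?orthonormal_col //.
move: gap0 => /eqP; rewrite psumr_eq0 // => /allP /(_ i (mem_index_enum i)).
by rewrite /= mulf_eq0 (negPf ai0) subr_eq0 => /eqP /esym.
Qed.

Hypotheses (delta_gt0 : 0 < delta) (symS : S^T = S).
Let M := delta *: (col 0 U *m (col 0 V)^T).

Lemma argmin_rank_one :
  argmin (nuclear_ball delta) (fun A => frob_dot A (- S)) M <-> M^T = M.
Proof.
have dotN A : frob_dot A (- S) = - frob_dot A S.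
  by rewrite /frob_dot mulmxN linearN.
split=> [[[]]//|symM]; split=> [|A A_ball].
  by split=> //; rewrite (nuclear_norm_rank_one svdS) // ltW.
by rewrite !dotN lerN2 frob_dot_rank_one frob_dot_le.
Qed.

(* For symmetric [S], [u + v] and [u - v] are eigenvectors of [S] for [s 0 0]
   and [- s 0 0], unless they vanish. *)
Lemma rank_one_sym :
  ~ (eigenvalue S (s 0 0) /\ eigenvalue S (- s 0 0)) -> M^T = M.
Proof.
have [UU VV _ _ _] := svdS.
have uS : (col 0 U)^T *m S = s 0 0 *: (col 0 V)^T.
  rewrite tr_col -row_mul (svd_mulUl svdS); apply/matrixP => i j.
  by rewrite mxE mul_diag_mx !mxE.
have vS : (col 0 V)^T *m S = s 0 0 *: (col 0 U)^T.
  rewrite -{1}symS -trmx_mul -[in RHS]linearZ /= colE mulmxA (svd_mulVr svdS).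
  congr (_^T); apply/matrixP => i j.
  by rewrite -colE mxE mul_mx_diag !mxE mulrC.
have [uE|uv0] := eqVneq (col 0 U) (col 0 V).
  by rewrite /M uE linearZ /= trmx_mul trmxK.
have [uE|uv0'] := eqVneq (col 0 U) (- col 0 V).
  by rewrite /M uE linearZ /= trmx_mul trmxK linearN /= mulmxN mulNmx.
case; split; apply/eigenvalueP.
  exists ((col 0 U)^T + (col 0 V)^T); last first.
    by rewrite -linearD /= trmx_eq0 addr_eq0.
  by rewrite mulmxDl uS vS scalerDr addrC.
exists ((col 0 U)^T - (col 0 V)^T); last first.
  by rewrite -linearB /= trmx_eq0 subr_eq0.
by rewrite mulmxBl uS vS scalerBr !scaleNr opprK addrC.
Qed.

End LinearOptimization.

(** * Maximal singular vectors in the linear step of a round *)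

Theorem theorem1 (R : realType) (d T : nat) (delta eta : R)
    (x : nat -> 'cV[R]_d) (l : nat -> R -> R) (C Chat : nat -> 'M[R]_d.+1)
    (delta_gt0 : 0 < delta) (eta_gt0 : 0 < eta)
    (l_derivable : forall t, (1 <= t <= T)%N ->
       forall y : R, derivable (l t : R^o -> R^o) y 1)
    (l_convex : forall t, (1 <= t <= T)%N ->
       convex_function (E := R^o) setT (l t))
    (run : occfm_run delta eta T x l C Chat)
    (t : nat) (t_round : (1 <= t <= T)%N)
    (Ct_in : nuclear_ball delta (C t)) :
  let G := gradient (surrogate eta x l C t) (C t) in
  let LO := argmin (nuclear_ball delta) (fun A => frob_dot A G) in
  let s := singular_values (- G) in
  [/\ exists u v, maximal_singular_vectors (- G) u v
        /\ LO (delta *: (u *m v^T)),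
      forall u v, maximal_singular_vectors (- G) u v ->
        let M := delta *: (u *m v^T) in
        [/\ forall A, nuclear_ball delta A -> frob_dot M G <= frob_dot A G,
            LO M <-> M^T = M,
            ~ (eigenvalue (- G) (s 0 ord0) /\ eigenvalue (- G) (- s 0 ord0)) ->
              LO M
          & 0 < s 0 ord0 -> (forall i, i != ord0 -> s 0 i < s 0 ord0) ->
              LO = [set M]]
    & LO (Chat t) <-> (Chat t)^T = Chat t].

Proof.
have symC1 : (C 1%N)^T = C 1%N by case: (occfm_init run).
have symG : (gradient (surrogate eta x l C t) (C t))^T =
    gradient (surrogate eta x l C t) (C t).
  by apply: gradient_surrogate_sym => //; case: Ct_in.
move=> G LO s; pose S : 'M[R]_d.+1 := - G.
have symS : S^T = S by rewrite /S linearN /= symG.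
have LOE : LO = argmin (nuclear_ball delta) (fun A => frob_dot A (- S)).
  by rewrite /LO /S opprK.
(* An SVD exists because [S] is symmetric, so [s] is not the default value of [xget]. *)
have [U0 [V0 svd0]] : exists U V, is_svd S U s V.
  rewrite /s /singular_values; case: xgetP => [r _ //|].
  have [U [r [V [svdS _]]]] := symmetric_svd symS.
  by move=> /(_ r) nex; case: nex; exists U, V.
have LO_msv u v : maximal_singular_vectors S u v ->
    LO (delta *: (u *m v^T)) <-> (delta *: (u *m v^T))^T = delta *: (u *m v^T).
  move=> [U [r [V [svdS -> ->]]]]; rewrite LOE.
  exact: (argmin_rank_one svdS).
split.
- have [U [r [V [svdS UV]]]] := symmetric_svd symS.
  exists (col ord0 U), (col ord0 V); split; first by exists U, r, V.
  apply/LO_msv; first by exists U, r, V.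
  have [e ->] := UV ord0.
  by rewrite -scalemxAl scalerA linearZ /= trmx_mul trmxK.
- move=> u v uv M.
  have [U [r [V [svdS uE vE]]]] : maximal_singular_vectors S u v := uv.
  have r0 : r 0 0 = s 0 0 by rewrite (top_singular_value_uniq svd0 svdS).
  have dotG A : frob_dot A G = - frob_dot A S.
    by rewrite /frob_dot /S mulmxN linearN opprK.
  have maxM : frob_dot M S = delta * r 0 0.
    by rewrite /M uE vE; apply: (frob_dot_rank_one svdS).
  split.
  + move=> A A_ball; rewrite !dotG lerN2 maxM.
    exact: (frob_dot_le svdS).
  + exact: LO_msv.
  + move=> eig; apply/LO_msv => //; rewrite uE vE.
    apply: (rank_one_sym svdS) => //; by rewrite r0.
  + move=> s_gt0 s_lt.
    have [UU VV _ _ _] := svdS.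
    (* The simplicity hypothesis concerns [s], so maximizing pairs are compared with the SVD [U0],
       [V0] that realizes [s]. *)
    have uv_max (x' y' : 'cV[R]_d.+1) : x'^T *m x' = 1%:M ->
        y'^T *m y' = 1%:M ->
        (x'^T *m S *m y') 0 0 = s 0 0 -> x' *m y'^T = col 0 U0 *m (col 0 V0)^T.
      by move=> *; apply: (svd_bilinear_max svd0).
    have uvE : u *m v^T = col 0 U0 *m (col 0 V0)^T.
      by rewrite uE vE uv_max ?orthonormal_col // (svd_bilinear_col _ svdS).
    (* By symmetry of [S] the swapped pair [(v, u)] is also maximizing, so [v u^T] and [u v^T]
       coincide and [M] is symmetric. *)
    have vuE : v *m u^T = col 0 U0 *m (col 0 V0)^T.
      rewrite uE vE uv_max ?orthonormal_col // -r0 -(svd_bilinear_col 0 svdS).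
      rewrite -{1}symS -[col 0 U in LHS]trmxK -!trmx_mul mulmxA.
      by rewrite [LHS]mxE.
    have LOM : LO M.
      by apply/LO_msv => //; rewrite linearZ /= trmx_mul trmxK vuE uvE.
    apply/seteqP; split=> [A [A_ball A_min]|_ ->] //=.
    (* A minimizer [A] does at least as well as [M], which lies in the ball; with the upper bound
       this puts [A] in the equality case. *)
    rewrite /M uvE; apply: (frob_dot_max svd0) => //; apply/eqP; rewrite eq_le.
    rewrite (frob_dot_le svd0 A_ball) /= -r0 -maxM -lerN2 -!dotG.
    by apply: A_min; case: LOM.
- have [u [v [uv ->]]] := occfm_linear_opt run t_round.
  exact: LO_msv.
Qed.
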